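(* Let the kernel $\gamma$ be radial, nonnegative and symmetric with $0<\int_{-\delta}^{\delta}s^2\gamma(s)\,ds<\infty$. Let $u_h^n\in V_h^k$ and $q_h^n=q_h^n(\cdot;s)\in V_h^k$ ($s\in(0,\delta]$, $n=0,1,\dots,N_t$) solve the fully discrete (Crank–Nicolson) DG scheme: for every $n$ with $1\le n\le N_t-1$, every $j$, every $s\in(0,\delta]$, and all $v_h,w_h\in V_h^k$, $$\int_{I_j}\frac{u_h^{n+1}-2u_h^n+u_h^{n-1}}{h_t^2}\,v_h\,dx-2\int_0^\delta s^2\gamma(s)\,\mathcal K_j\Big(\frac{q_h^{n+1}+q_h^{n-1}}2,v_h;s\Big)ds=0,$$ $$\int_{I_j}q_h^{n+1}w_h\,dx-\mathcal H_j(u_h^{n+1},w_h;s)=0,\qquad \int_{I_j}q_h^{n-1}w_h\,dx-\mathcal H_j(u_h^{n-1},w_h;s)=0 .$$ Define $$E_h^{n+1}:=\Big\|\frac{u_h^{n+1}-u_h^n}{h_t}\Big\|_{L^2(a,b)}^2+\int_0^\delta s^2\gamma(s)\Big(\|q_h^{n+1}\|_{L^2(a,b)}^2+\|q_h^n\|_{L^2(a,b)}^2\Big)ds .$$ Then the discrete energy is conserved: $E_h^{n+1}=E_h^n$ for all $n$ (i.e. $1\le n\le N_t-1$).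
   Context: Setting: the scheme discretizes the one-dimensional nonlocal wave equation $u_{tt}(x,t)+\mathcal L_\delta u(x,t)=0$ on $(a,b)\times(0,T)$ with periodic boundary conditions, where $\mathcal L_\delta u(x,t)=-2\int_{x-\delta}^{x+\delta}(u(y,t)-u(x,t))\gamma(x-y)\,dy$, $\delta>0$ is the horizon, and $\gamma(x,y)=\gamma(x-y)$ is a nonnegative symmetric (even) kernel; $q$ is the auxiliary variable $q(x,t;s)=\frac1s(u(x+s,t)-u(x,t))$. Time grid: $0=t_0<t_1<\dots<t_{N_t}=T$ with uniform step $h_t=t_{n+1}-t_n$; $u_h^n$, $q_h^n$ denote the DG solution at $t=t_n$. Mesh and space: $(a,b)$ is divided into subintervals $I_j=(x_{j-1/2},x_{j+1/2})$, $j=1,\dots,N$, $a=x_{1/2}<\dots<x_{N+1/2}=b$, with $\nu\max_j|I_j|\le\min_j|I_j|$ for a positive constant $\nu$. $V_h^k$ is the space of functions whose restriction to each $I_j$ is a polynomial of degree at most $k$ ($k\ge0$ an integer). All functions are extended periodically with period $b-a$. $\|\cdot\|_{L^2(a,b)}$ is the usual $L^2$ norm. Operators: for $s>0$, $\mathcal H_j(v,w;s)=\int_{I_j}\frac1s(v(x+s)-v(x))w(x)\,dx$ and $\mathcal K_j(v,w;s)=\int_{I_j}\frac1s(v(x)-v(x-s))w(x)\,dx$. *)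

(* Defs.v *)
From HB Require Import structures.
From mathcomp Require Import all_boot all_order all_algebra.
From mathcomp Require Import all_classical all_reals all_analysis.

Set Implicit Arguments.
Unset Strict Implicit.
Unset Printing Implicit Defensive.

Import Order.TTheory GRing.Theory Num.Theory.
Import numFieldNormedType.Exports.

Local Open Scope classical_set_scope.
Local Open Scope ring_scope.

(* gamma(x, y) = gamma(x - y); in dimension one, radial and symmetric both mean
   even. The value at 0 is immaterial, so kernels that are singular at the
   origin are covered. *)
Definition nonlocal_kernel (R : realType) (delta : R) (gamma : R -> R) : Prop :=
  [/\ forall s, 0 <= gamma s,
      forall s, gamma (- s) = gamma s,
      measurable_fun `[- delta, delta] gamma &
      (0 < \int[lebesgue_measure]_(s in `[(- delta)%R, delta])
             (s ^+ 2 * gamma s)%:E < +oo)%E].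

Definition uniform_time_grid (R : realType) (T ht : R) (Nt : nat) (t : nat -> R)
    : Prop :=
  [/\ 0 < ht, t 0%N = 0, t Nt = T
    & forall n, (n < Nt)%N -> t n.+1 - t n = ht].

(* [x i] is the mesh point x_{i+1/2} for 0 <= i <= N (later values are
   irrelevant), and the j-th cell, 0 <= j < N, is ]x j, x j.+1[. *)
Definition cell (R : realType) (x : nat -> R) (j : nat) : set R :=
  `]x j, x j.+1[.

Definition cell_size (R : realType) (x : nat -> R) (j : nat) : R :=
  x j.+1 - x j.

Definition quasi_uniform_mesh (R : realType) (a b nu : R) (N : nat)
    (x : nat -> R) : Prop :=
  [/\ x 0%N = a, x N = b,
      forall j, (j < N)%N -> x j < x j.+1
    & forall i j, (i < N)%N -> (j < N)%N ->
        nu * cell_size x i <= cell_size x j].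

(* V_h^k, with the periodic extension to R built in. The cells are open: values
   at mesh points are unconstrained and do not affect any integral. *)
Definition DG_space (R : realType) (a b : R) (N : nat) (x : nat -> R) (k : nat)
    : set (R -> R) :=
  [set v | (forall y, v (y + (b - a)) = v y) /\
    forall j, (j < N)%N -> exists p : {poly R},
      (size p <= k.+1)%N /\ forall y, cell x j y -> v y = p.[y]].

Definition cell_prod (R : realType) (x : nat -> R) (j : nat) (v w : R -> R) : R :=
  \int[lebesgue_measure]_(y in cell x j) (v y * w y).

Definition Hform (R : realType) (x : nat -> R) (j : nat) (v w : R -> R) (s : R)
    : R :=
  \int[lebesgue_measure]_(y in cell x j) (s^-1 * (v (y + s) - v y) * w y).

Definition Kform (R : realType) (x : nat -> R) (j : nat) (v w : R -> R) (s : R)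
    : R :=
  \int[lebesgue_measure]_(y in cell x j) (s^-1 * (v y - v (y - s)) * w y).

(* [q n s] is the function q_h^n(.; s). *)
Definition CN_DG_scheme (R : realType) (a b delta ht : R) (gamma : R -> R)
    (N : nat) (x : nat -> R) (k Nt : nat)
    (u : nat -> R -> R) (q : nat -> R -> R -> R) : Prop :=
  let V := DG_space a b N x k in
  [/\ forall n, (n <= Nt)%N -> V (u n),
      forall n (s : R), (n <= Nt)%N -> 0 < s <= delta -> V (q n s),
      forall n j v, (1 <= n <= Nt - 1)%N -> (j < N)%N -> V v ->
        cell_prod x j
          (fun y => (u n.+1 y - 2 * u n y + u n.-1 y) / ht ^+ 2) v
        - 2 * \int[lebesgue_measure]_(s in `]0, delta[)
                (s ^+ 2 * gamma s *
                 Kform x j (fun y => (q n.+1 s y + q n.-1 s y) / 2) v s) = 0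
    & forall n j (s : R) w, (1 <= n <= Nt - 1)%N -> (j < N)%N ->
        0 < s <= delta -> V w ->
        cell_prod x j (q n.+1 s) w - Hform x j (u n.+1) w s = 0 /\
        cell_prod x j (q n.-1 s) w - Hform x j (u n.-1) w s = 0].

Definition L2norm (R : realType) (a b : R) (f : R -> R) : \bar R :=
  ('N[lebesgue_measure]_2%:E [(EFin \o f) \_ `]a, b[])%E.

(* E_h^n for n >= 1. It is extended-real valued, so that no integrability of
   s |-> s^2 gamma(s) ||q_h^n(.; s)||^2 has to be presupposed. *)
Definition discrete_energy (R : realType) (a b delta ht : R) (gamma : R -> R)
    (u : nat -> R -> R) (q : nat -> R -> R -> R) (n : nat) : \bar R :=
  (L2norm a b (fun y => (u n y - u n.-1 y) / ht)%R ^+ 2 +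
   \int[lebesgue_measure]_(s in `]0%R, delta[)
     ((s ^+ 2 * gamma s)%:E *
      (L2norm a b (q n s) ^+ 2 + L2norm a b (q n.-1 s) ^+ 2)))%E.

(* Main.v *)
Require Import Defs.
From HB Require Import structures.
From mathcomp Require Import all_boot all_order all_algebra.
From mathcomp Require Import all_classical all_reals all_analysis.
From mathcomp Require Import measurable_realfun.
From mathcomp Require Import zify ring lra.

Set Implicit Arguments.
Unset Strict Implicit.
Unset Printing Implicit Defensive.

Import Order.TTheory GRing.Theory Num.Theory.
Import numFieldNormedType.Exports.

Local Open Scope classical_set_scope.
Local Open Scope ring_scope.

(* Test the scheme with [v = u^{n+1} - u^{n-1}] and sum over the cells. The
   inertial term becomes the difference of two squared norms of discrete
   velocities. By periodicity [sum_j K_j(Q, v; s) = - sum_j H_j(v, Q; s)], and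
   for [Q = (q^{n+1} + q^{n-1}) / 2] the equations for [q] turn the right-hand
   side into [- (|q^{n+1}|^2 - |q^{n-1}|^2) / 2]; it remains to integrate in [s].

   The integrals in [s] can be split because everything in sight is measurable
   and bounded in [s]: the forms [H_j(v, w; s)] are, since [v] is piecewise
   Lipschitz, and the coefficients of [q(.; s)] on a cell are such forms. The
   level [q^n] need not be determined by the scheme, hence may depend on [s] in a
   non-measurable way; it contributes the same lower integral to both energies. *)

(** * Bounded measurable functions *)

(** This class is closed under the algebra of the integrands and is integrable on sets of finite
    measure, so it replaces separate integrability checks. The bound is pointwise rather than almost
    everywhere, which makes it stable under composition. *)
Definition bounded_measurable d (T : measurableType d) (R : realType)
    (D : set T) (f : T -> R) : Prop :=
  measurable_fun D f /\ exists M : R, forall y, D y -> `|f y| <= M.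

Section bounded_measurable.
Context d (T : measurableType d) (R : realType) (D : set T).
Implicit Types f g : T -> R.

Lemma bounded_measurable_sub f (A : set T) : measurable D -> A `<=` D ->
  bounded_measurable D f -> bounded_measurable A f.
Proof.
move=> mD AD [mf [M fM]]; split; first exact: measurable_funS mf.
by exists M => y /AD/fM.
Qed.

Lemma bounded_measurable_ext f g : {in D, f =1 g} ->
  bounded_measurable D f -> bounded_measurable D g.
Proof.
move=> fg [mf [M fM]]; split; first exact: eq_measurable_fun mf.
by exists M => y Dy; rewrite -fg ?inE//; exact: fM.
Qed.

Lemma bounded_measurable_cst (c : R) : bounded_measurable D (fun=> c).
Proof. by split; [exact: measurable_cst | exists `|c|]. Qed.

Lemma bounded_measurableD f g : bounded_measurable D f ->
  bounded_measurable D g -> bounded_measurable D (fun y => f y + g y).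
Proof.
move=> [mf [M fM]] [mg [P gP]]; split; first exact: measurable_funD.
by exists (M + P) => y Dy; rewrite (le_trans (ler_normD _ _))// lerD ?fM ?gP.
Qed.

Lemma bounded_measurableM f g : bounded_measurable D f ->
  bounded_measurable D g -> bounded_measurable D (fun y => f y * g y).
Proof.
move=> [mf [M fM]] [mg [P gP]]; split; first exact: measurable_funM.
by exists (M * P) => y Dy; rewrite normrM ler_pM ?fM ?gP.
Qed.

Lemma bounded_measurableZ (c : R) f : bounded_measurable D f ->
  bounded_measurable D (fun y => c * f y).
Proof.
by move=> bf; apply: bounded_measurableM bf; exact: bounded_measurable_cst.
Qed.

Lemma bounded_measurableB f g : bounded_measurable D f ->
  bounded_measurable D g -> bounded_measurable D (fun y => f y - g y).
Proof.
move=> bf /(bounded_measurableZ (-1)) bg.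
by apply: bounded_measurable_ext (bounded_measurableD bf bg) => y _; rewrite mulN1r.
Qed.

Lemma bounded_measurable_sum I (r : seq I) (F : I -> T -> R) :
  (forall i, bounded_measurable D (F i)) ->
  bounded_measurable D (fun y => \sum_(i <- r) F i y).
Proof.
move=> bF; elim: r => [|i r ih].
  by apply: bounded_measurable_ext (bounded_measurable_cst 0) => y _; rewrite big_nil.
apply: bounded_measurable_ext (bounded_measurableD (bF i) ih) => y _.
by rewrite big_cons.
Qed.

Lemma bounded_measurable_integrable (mu : {measure set T -> \bar R}) f :
  measurable D -> (mu D < +oo)%E -> bounded_measurable D f ->
  mu.-integrable D (EFin \o f).
Proof.
move=> mD muD [mf [M fM]]; apply: measurable_bounded_integrable => //.
exists M; split; first exact: num_real.
by move=> N MN y /= Dy; rewrite (le_trans (fM _ Dy))// ltW.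
Qed.

(** Meant for the weight [s ^+ 2 * gamma s], which is integrable but possibly unbounded. *)
Lemma integrable_bounded_measurableM (mu : {measure set T -> \bar R}) f g :
  measurable D -> mu.-integrable D (EFin \o g) -> bounded_measurable D f ->
  mu.-integrable D (EFin \o (fun y => g y * f y)).
Proof.
move=> mD ig [mf [M fM]].
have mg : measurable_fun D g by apply/measurable_EFinP; exact: measurable_int ig.
apply: (@le_integrable _ _ _ mu D mD _ (fun y => (M%:E * (EFin \o g) y)%E)).
- by apply/measurable_EFinP; exact: measurable_funM.
- move=> y Dy /=; rewrite lee_fin !normrM mulrC ler_wpM2r//.
  by rewrite (le_trans (fM _ Dy))// ler_norm.
- exact: integrableZl.
Qed.

End bounded_measurable.

Lemma bounded_measurableU d (T : measurableType d) (R : realType)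
    (A B : set T) (f : T -> R) :
  measurable A -> measurable B -> bounded_measurable A f ->
  bounded_measurable B f -> bounded_measurable (A `|` B) f.
Proof.
move=> mA mB [mf [M fM]] [mf' [P fP]]; split; first exact/measurable_funU.
by exists (Num.max M P) => y [/fM|/fP] H; rewrite le_max H ?orbT.
Qed.

Lemma bounded_measurable_comp d1 d2 (T1 : measurableType d1)
    (T2 : measurableType d2) (R : realType) (h : T1 -> T2) (f : T2 -> R) :
  measurable_fun setT h -> bounded_measurable setT f ->
  bounded_measurable setT (f \o h).
Proof.
move=> mh [mf [M fM]]; split; first exact: measurableT_comp.
by exists M => y _; exact: fM.
Qed.

Lemma bounded_measurable_indic d (T : measurableType d) (R : realType)
    (A : set T) :
  measurable A -> bounded_measurable setT (\1_A : T -> R).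
Proof.
move=> mA; split; first exact: measurable_indic.
by exists 1 => y _; rewrite indicE; case: (_ \in _); rewrite ?normr1 ?normr0.
Qed.

Lemma Rintegral_sum d (T : measurableType d) (R : realType)
    (mu : {measure set T -> \bar R}) (D : set T) I (r : seq I) (F : I -> T -> R) :
  measurable D -> (forall i, mu.-integrable D (EFin \o F i)) ->
  \int[mu]_(y in D) (\sum_(i <- r) F i y) =
  \sum_(i <- r) \int[mu]_(y in D) F i y.
Proof.
move=> mD iF; elim: r => [|i r ih].
  rewrite big_nil; under eq_Rintegral do rewrite big_nil.
  by rewrite Rintegral_cst// mul0r.
rewrite big_cons -ih; under eq_Rintegral do rewrite big_cons.
rewrite RintegralD//.
rewrite (_ : EFin \o _ = fun y => (\sum_(j <- r) (EFin \o F j) y)%E); last first.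
  by apply/funext => y /=; rewrite sumEFin.
exact: integrable_sum.
Qed.

(** * Lower integrals of non-measurable functions *)

Section nonmeasurable_integrands.
Import HBNNSimple.

(** A simple function below [f] is also below [g], so the supremum defining the second integral runs
    over a larger set. *)
Lemma ge0_le_integral_nonmeasurable d (T : measurableType d) (R : realType)
    (mu : {measure set T -> \bar R}) (f g : T -> \bar R) :
  (forall y, 0 <= f y)%E -> (forall y, f y <= g y)%E ->
  (\int[mu]_y f y <= \int[mu]_y g y)%E.
Proof.
move=> f0 fg; rewrite !ge0_integralTE//; last by move=> y; exact: le_trans (fg y).
apply: ge_ereal_sup => _ [h /= hf <-]; apply: ereal_sup_ubound; exists h => //= y.
exact: le_trans (fg y).
Qed.

(* The integral of a nonnegative function is a supremum over simple functions
   below it, so additivity needs only one of the two summands to be measurable. *)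
Lemma ge0_integralD_nonmeasurable d (T : measurableType d) (R : realType)
    (mu : {measure set T -> \bar R}) (D : set T) (f : T -> R) (g : T -> \bar R) :
  measurable D -> (forall y, D y -> 0 <= f y) ->
  mu.-integrable D (EFin \o f) -> (forall y, D y -> (0 <= g y)%E) ->
  (\int[mu]_(y in D) ((f y)%:E + g y) =
   \int[mu]_(y in D) (f y)%:E + \int[mu]_(y in D) g y)%E.
Proof.
move=> mD f0 intf g0.
rewrite integral_mkcond [X in (_ = X + _)%E]integral_mkcond.
rewrite [X in (_ = _ + X)%E]integral_mkcond.
have {}intf : mu.-integrable setT (EFin \o (f \_ D)).
  by rewrite -restrict_EFin; apply/(integrable_mkcond _ mD).
rewrite (_ : (fun y => (f y)%:E) \_ D = EFin \o (f \_ D)); last by rewrite restrict_EFin.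
set F := f \_ D in intf *; set G := g \_ D.
rewrite (_ : _ \_ D = fun y => ((F y)%:E + G y)%E); last first.
  apply/funext => y; rewrite /F /G !patchE; case: ifP => // _; by rewrite adde0.
have F0 y : 0 <= F y.
  by rewrite /F patchE; case: ifP => // /set_mem /f0.
have G0 y : (0 <= G y)%E.
  by rewrite /G patchE; case: ifP => // /set_mem /g0.
have mF : measurable_fun setT F by apply/measurable_EFinP; exact: measurable_int intf.
have FD (k : T -> R) : measurable_fun setT k -> (forall y, 0 <= k y) ->
    (\int[mu]_y (F y + k y)%:E = \int[mu]_y (F y)%:E + \int[mu]_y (k y)%:E)%E.
  move=> mk k0; under eq_integral do rewrite EFinD.
  rewrite ge0_integralD//; first by move=> y _; rewrite lee_fin.
  - exact/measurable_EFinP.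
  - by move=> y _; rewrite lee_fin.
  - exact/measurable_EFinP.
apply/eqP; rewrite eq_le; apply/andP; split.
  rewrite [X in (X <= _)%E]ge0_integralTE; last first.
    by move=> y; rewrite adde_ge0// lee_fin.
  apply: ge_ereal_sup => _ [h /= hFG <-].
  (* The excess of [h] over [F] is measurable because [F] is. It satisfies [h <= F + k], and
     [k <= G] because [h <= F + G] and [G] is nonnegative. *)
  pose k y := Num.max (h y - F y) 0.
  have k0 y : 0 <= k y by rewrite /k le_max lexx orbT.
  have mk : measurable_fun setT k.
    by apply: measurable_maxr => //; exact: measurable_funB.
  rewrite -integralT_nnsfun.
  apply: (@le_trans _ _ (\int[mu]_y (F y + k y)%:E)%E).
    apply: ge0_le_integral_nonmeasurable => y /=; first by rewrite lee_fin.
    by rewrite lee_fin -lerBlDl /k le_max lexx.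
  rewrite FD// leeD2l//; apply: ge0_le_integral_nonmeasurable => y /=.
    by rewrite lee_fin.
  rewrite /k; have [hF|hF] := leP (h y - F y) 0; first exact: G0.
  by rewrite EFinB leeBlDl// hFG.
(* Finiteness allows the integral of [F] to move to the other side, leaving a supremum over simple
   functions below [G]. *)
have Ffin : (\int[mu]_y (F y)%:E)%E \is a fin_num by exact: integrable_fin_num intf.
rewrite -leeBrDl//.
rewrite [X in (X <= _)%E]ge0_integralTE//; apply: ge_ereal_sup => _ [k /= kG <-].
rewrite leeBrDl// -integralT_nnsfun.
rewrite -FD//; apply: ge0_le_integral_nonmeasurable => y /=.
  by rewrite lee_fin addr_ge0.
by rewrite EFinD leeD2l.
Qed.

End nonmeasurable_integrands.

(** * Translation invariance and periodic functions *)

Section lebesgue_shift.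
Context (R : realType).
Local Notation mu := (@lebesgue_measure R).

Let measurable_shift (s : R) :
  measurable_fun setT (fun y : R => y + s : measurableTypeR R).
Proof. by apply: measurable_funD => //; exact: measurable_cst. Qed.

(** By uniqueness of Lebesgue measure it suffices to compare lengths of half-open intervals. *)
Lemma lebesgue_measure_shift (s : R) (A : set R) : measurable A ->
  pushforward mu (fun y : R => y + s : measurableTypeR R) A = mu A.
Proof.
move=> mA; apply/esym/lebesgue_measure_unique => //=.
  exact: measurable_shift.
move=> mshift _ [[c d] _ <-] /=.
rewrite /pushforward (_ : _ @^-1` _ = `]c - s, d - s]%classic); last first.
  by apply/seteqP; split => y /=; rewrite !in_itv /= ltrBlDr lerBrDr.
rewrite !lebesgue_measure_itv /= !lte_fin ltrD2r; case: ifPn => // _.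
by rewrite -!EFinB; congr EFin; lra.
Qed.

Lemma integral_shift (s : R) (f : R -> \bar R) : measurable_fun setT f ->
  (\int[mu]_y f (y + s)%R = \int[mu]_y f y)%E.
Proof.
have H (g : R -> \bar R) : measurable_fun setT g -> (forall y, 0 <= g y)%E ->
    (\int[mu]_y g (y + s)%R = \int[mu]_y g y)%E.
  move=> mg g0.
  transitivity (\int[pushforward mu (fun y : R => (y + s)%R : measurableTypeR R)]_y g y)%E.
    rewrite ge0_integral_pushforward//=; exact: measurable_shift.
  apply: eq_measure_integral => //=; first exact: measurable_shift.
  by move=> mshift A mA _; exact: lebesgue_measure_shift.
move=> mf; rewrite integralE [RHS]integralE; congr (_ - _)%E.
- rewrite -(H f^\+%E)//; last exact: measurable_funepos.
  by apply: eq_integral => y _; rewrite !funeposE.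
- rewrite -(H f^\-%E)//; last exact: measurable_funeneg.
  by apply: eq_integral => y _; rewrite !funenegE.
Qed.

Lemma Rintegral_itv_shift (c d s : R) (f : R -> R) : measurable_fun setT f ->
  \int[mu]_(y in `[c + s, d + s[) f y = \int[mu]_(y in `[c, d[) f (y + s).
Proof.
move=> mf; rewrite Rintegral_mkcond [RHS]Rintegral_mkcond /Rintegral; congr fine.
rewrite -(@integral_shift s); last first.
  by apply/measurable_EFinP/(measurable_restrictT _ _).1 => //; exact: measurable_funS mf.
apply: eq_integral => y _; rewrite !patchE; congr ((if _ then _ else _)%:E).
by apply/idP/idP; rewrite !inE /= !in_itv /= lerD2r ltrD2r.
Qed.

Lemma Rintegral_itv_split (c d e : R) (f : R -> R) : c <= d -> d <= e ->
  bounded_measurable setT f ->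
  \int[mu]_(y in `[c, e[) f y =
  \int[mu]_(y in `[c, d[) f y + \int[mu]_(y in `[d, e[) f y.
Proof.
move=> cd de bf; rewrite (@itv_bndbnd_setU _ _ _ (BLeft d)) ?bnd_simp//.
rewrite Rintegral_setU//.
- rewrite -itv_bndbnd_setU ?bnd_simp//.
  apply: bounded_measurable_integrable => //=.
    by rewrite lebesgue_measure_itv; case: ifP => _; rewrite ?ltry.
  exact: bounded_measurable_sub bf.
- apply/disj_setPS => y /= []; rewrite !in_itv /= => /andP[_ yd] /andP[dy _].
  by move: yd; rewrite ltNge dy.
Qed.

End lebesgue_shift.

Section periodic.
Context (R : realType).
Local Notation mu := (@lebesgue_measure R).
Implicit Types (a p s y : R) (f : R -> R).

(** For [0 < p], the representative of [y] modulo [p] in [[a, a + p[]. *)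
Definition wrapr a p y := y - p * (Num.floor ((y - a) / p))%:~R.

Lemma wrapr_itv a p y : 0 < p -> a <= wrapr a p y < a + p.
Proof.
move=> p0; rewrite /wrapr; set m := Num.floor _.
have /andP[h1 h2] := floor_itv ((y - a) / p).
rewrite ler_pdivlMr// in h1; rewrite ltr_pdivrMr// intrD mulrDl mul1r in h2.
by rewrite -/m in h1 h2; apply/andP; split; [lra | nra].
Qed.

Lemma wrapr_id a p y : 0 < p -> a <= y < a + p -> wrapr a p y = y.
Proof.
move=> p0 /andP[ay yap]; rewrite /wrapr.
suff -> : Num.floor ((y - a) / p) = 0 by rewrite mulr0 subr0.
apply: floor_def; rewrite ler_pdivlMr// ltr_pdivrMr//.
by rewrite add0r mul0r mul1r; apply/andP; split; lra.
Qed.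

Lemma wraprDp a p y : 0 < p -> wrapr a p (y + p) = wrapr a p y.
Proof.
move=> p0; rewrite /wrapr.
have -> : (y + p - a) / p = (y - a) / p + 1 by field; exact: lt0r_neq0.
by rewrite floorDrz// floor1 intrD; ring.
Qed.

Lemma measurable_wrapr a p : 0 < p -> measurable_fun setT (wrapr a p).
Proof.
move=> p0; apply: measurable_funB => //; apply: measurable_funM => //.
apply: nondecreasing_measurable => // y z yz.
by rewrite ler_int le_floor// ler_pM2r ?invr_gt0// lerD2r.
Qed.

Lemma periodic_wrapr a p s f : (forall y, f (y + p) = f y) ->
  forall y, f (wrapr a p s + y) = f (s + y).
Proof.
move=> fp y.
have fn n z : f (z + p * n%:R) = f z.
  by elim: n => [|n ih]; rewrite ?mulr0 ?addr0// -natr1 mulrDr mulr1 addrA fp.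
(* Only nonnegative multiples of the period are available from [fn]; for a negative floor they are
   added on the right-hand side instead. *)
rewrite /wrapr; case: (Num.floor _) => n.
  by rewrite -(fn n) pmulrn; congr f; ring.
by rewrite -[RHS](fn n.+1) NegzE mulrNz -pmulrn; congr f; ring.
Qed.

Lemma Rintegral_periodic_shift a p s f : 0 < p -> (forall y, f (y + p) = f y) ->
  bounded_measurable setT f ->
  \int[mu]_(y in `[a, a + p[) f (y + s) = \int[mu]_(y in `[a, a + p[) f y.
Proof.
move=> p0 fp bf; have [mf _] := bf.
under eq_Rintegral do rewrite addrC -(periodic_wrapr 0 _ fp) addrC.
have /andP[] := wrapr_itv 0 s p0; rewrite add0r; move: (wrapr 0 p s) => r r0 rp.
rewrite -Rintegral_itv_shift//.
(* With the shift reduced to [0 <= r < p], the window [[a + r, a + p + r[] is cut at [a + p]; its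
   second piece moves back by one period onto [[a, a + r[]. *)
rewrite (@Rintegral_itv_split _ _ (a + p))//; [|lra|lra].
rewrite [in X in _ + X]addrAC Rintegral_itv_shift//.
under [X in _ + X]eq_Rintegral do rewrite fp.
rewrite [RHS](@Rintegral_itv_split _ _ (a + r)); [exact: addrC | lra | lra | by []].
Qed.

End periodic.

(** * Meshes and DG spaces *)

Lemma horner_lipschitz (R : realType) (p : {poly R}) (c d : R) :
  exists L : R, forall y z, c <= y <= d -> c <= z <= d ->
    `|p.[y] - p.[z]| <= L * `|y - z|.
Proof.
elim/poly_ind: p => [|p e [L HL]].
  by exists 0 => y z _ _; rewrite !horner0 subrr normr0 mul0r.
have [M HM] := poly_itv_bound p c d.
(* Product rule for differences: [L] controls the increment of [p], [M] its values, and [|c| + |d|]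
   bounds [|y|]. *)
exists (L * (`|c| + `|d|) + M) => y z cy cz.
have -> : (p * 'X + e%:P).[y] - (p * 'X + e%:P).[z] =
    (p.[y] - p.[z]) * y + p.[z] * (y - z) by rewrite !hornerE; ring.
rewrite (le_trans (ler_normD _ _))// !normrM mulrDl lerD//; last first.
  by rewrite ler_wpM2r// HM.
rewrite mulrAC ler_pM ?HL//.
have := ler_norm d; have := ler_norm (- c); rewrite normrN.
by case/andP: cy => *; rewrite ler_norml; apply/andP; split;
  have := normr_ge0 c; have := normr_ge0 d; lra.
Qed.

Section mesh.
Context (R : realType) (a b nu : R) (N : nat) (x : nat -> R).
Hypothesis hmesh : quasi_uniform_mesh a b nu N x.
Local Notation mu := (@lebesgue_measure R).

Lemma mesh_le i j : (i <= j <= N)%N -> x i <= x j.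
Proof.
case: hmesh => _ _ xlt _; elim: j => [|j ih].
  by rewrite leqn0 andbT => /eqP ->.
rewrite leq_eqVlt => /andP[/orP[/eqP->//|ij] jN].
by rewrite (le_trans (ih _))// ?(ltW (xlt _ jN))// -ltnS ij ltnW.
Qed.

Lemma cell_itv j y : (j < N)%N -> cell x j y -> a <= y < b.
Proof.
move=> jN; rewrite /cell /= in_itv /= => /andP[xy yx].
have [<- <- _ _] := hmesh.
rewrite (le_trans _ (ltW xy)) ?mesh_le//=; last by rewrite ltnW.
by rewrite (lt_le_trans yx)// mesh_le// jN leqnn.
Qed.

Lemma cell_disjoint i j y : (i < N)%N -> (j < N)%N ->
  cell x i y -> cell x j y -> i = j.
Proof.
move=> iN jN; rewrite /cell /= !in_itv /= => /andP[xy yx] /andP[xy' yx'].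
apply/eqP; rewrite eqn_leq; apply/andP; split; rewrite leqNgt; apply/negP => ij.
- by have := @mesh_le j.+1 i; rewrite ij ltnW// => /(_ isT); lra.
- by have := @mesh_le i.+1 j; rewrite ij ltnW// => /(_ isT); lra.
Qed.

Lemma measurable_cell j : measurable (cell x j).
Proof. exact: measurable_itv. Qed.

Lemma cell_finite j : (mu (cell x j) < +oo)%E.
Proof. by rewrite /cell /= lebesgue_measure_itv; case: ifP => _; rewrite ?ltry. Qed.

Lemma cell_integrable j (f : R -> R) : bounded_measurable setT f ->
  mu.-integrable (cell x j) (EFin \o f).
Proof.
move=> bf; apply: bounded_measurable_integrable; first exact: measurable_cell.
  exact: cell_finite.
exact: bounded_measurable_sub bf.
Qed.

Lemma bounded_measurable_horner j (p : {poly R}) :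
  bounded_measurable (cell x j) (horner p).
Proof.
have [M HM] := poly_itv_bound p (x j) (x j.+1).
split; first exact: measurable_poly.
by exists M => y; rewrite /cell /= in_itv /= => /andP[? ?]; rewrite HM// !ltW.
Qed.

Lemma Rintegral_cells (f : R -> R) : bounded_measurable setT f ->
  \sum_(j < N) \int[mu]_(y in cell x j) f y = \int[mu]_(y in `[a, b[) f y.
Proof.
move=> bf; have [x0 xN xlt _] := hmesh; rewrite -x0 -xN.
suff H n : (n <= N)%N ->
    \sum_(j < n) \int[mu]_(y in cell x j) f y = \int[mu]_(y in `[x 0%N, x n[) f y.
  exact: H.
elim: n => [_|n ih nN].
  by rewrite big_ord0 set_itv_ge ?Rintegral_set0// bnd_simp ltxx.
rewrite big_ord_recr /= ih ?(ltnW nN)//.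
have xn : x 0%N <= x n by rewrite mesh_le// (ltnW nN).
rewrite (Rintegral_itv_split xn (ltW (xlt n nN)) bf).
(* The open cell and the half-open interval differ by a mesh point, a null set. *)
congr (_ + _); rewrite /cell Rintegral_itv_obnd_cbnd//.
exact: (cell_integrable n bf).
Qed.

Section DG_space.
Context (k : nat).
Local Notation V := (DG_space a b N x k).

(** One period is a finite union of cells, where [v] is a polynomial on a bounded interval, and of
    mesh points, where any value is allowed. Periodicity then gives the whole line. *)
Lemma bounded_measurable_DG v : a < b -> V v -> bounded_measurable setT v.
Proof.
move=> ab [vp vpoly]; have [x0 xN xlt _] := hmesh.
have bv : bounded_measurable `[a, b[ v.
  rewrite -x0 -xN; suff H n : (n <= N)%N -> bounded_measurable `[x 0%N, x n[ v by exact: H.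
  elim: n => [_|n ih nN].
    rewrite set_itv_ge ?bnd_simp ?ltxx//; split; first exact: measurable_fun_set0.
    by exists 0.
  rewrite (@itv_bndbnd_setU _ _ _ (BLeft (x n))); last 2 first.
  - by rewrite bnd_simp mesh_le// (ltnW nN).
  - by rewrite bnd_simp ltW// xlt.
  rewrite -(@setU1itv _ _ _ (x n) false) ?bnd_simp ?xlt//.
  apply: bounded_measurableU (ih (ltnW nN)) _ => //; first exact: measurableU.
  apply: bounded_measurableU => //.
    split; first exact: measurable_fun_set1.
    by exists `|v (x n)| => _ ->.
  have [p [_ vE]] := vpoly n nN.
  apply: (@bounded_measurable_ext _ _ _ _ (horner p)) => [y|].
    by rewrite inE => /vE.
  exact: bounded_measurable_horner.
have [mv [M vM]] := bv.
have ba : 0 < b - a by rewrite subr_gt0.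
(* Factoring through the measurable map [wrapr] transfers measurability and the bound from one
   period. *)
have vE : v = (v \_ `[a, b[) \o wrapr a (b - a).
  apply/funext => y /=; rewrite patchE.
  have := wrapr_itv a y ba; rewrite addrCA subrr addr0 => wy.
  rewrite mem_set//=.
  by have := periodic_wrapr a y vp 0; rewrite !addr0.
rewrite vE; apply: bounded_measurable_comp; first exact: measurable_wrapr.
split; first exact/(measurable_restrictT _ _).1.
exists M => y _; rewrite patchE; case: ifPn => [/set_mem/vM//|_].
by rewrite normr0 (le_trans _ (vM a _))//= in_itv /= lexx.
Qed.

Lemma DG_linear (c d : R) f g : V f -> V g -> V (fun y => c * f y + d * g y).
Proof.
move=> [fp fpoly] [gp gpoly]; split => [y|j jN]; first by rewrite fp gp.
have [p [sp pE]] := fpoly j jN; have [r [sr rE]] := gpoly j jN.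
exists (c *: p + d *: r); split.
  rewrite (leq_trans (size_polyD _ _))// geq_max.
  by rewrite !(leq_trans (size_scale_leq _ _)).
by move=> y cy; rewrite pE// rE// !hornerE.
Qed.

(** No continuity is imposed across cells, so arbitrary polynomials glue; evaluating at [wrapr]
    makes the result periodic. *)
Lemma exists_DG (P : nat -> {poly R}) : a < b ->
  (forall j, (size (P j) <= k.+1)%N) ->
  exists2 w, V w & forall j y, (j < N)%N -> cell x j y -> w y = (P j).[y].
Proof.
move=> ab sP; have ba : 0 < b - a by rewrite subr_gt0.
pose w y := \sum_(i < N) \1_(cell x i) (wrapr a (b - a) y)
                         * (P i).[wrapr a (b - a) y].
have wE j y : (j < N)%N -> cell x j y -> w y = (P j).[y].
  move=> jN cy; have := cell_itv jN cy => /andP[ay yb].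
  rewrite /w wrapr_id//; last by rewrite ay addrCA subrr addr0.
  rewrite (bigD1 (Ordinal jN))//= big1 ?addr0 => [|i ij].
    by rewrite indicE mem_set// mul1r.
  rewrite indicE memNset ?mul0r// => cy'.
  by move/eqP: ij; apply; apply/val_inj; exact: cell_disjoint cy' cy.
exists w => //; split => [y|j jN]; first by rewrite /w wraprDp.
by exists (P j); split=> // y; exact: wE.
Qed.

(** Cutting off to one cell stays in the space, so identities known only after summation over the
    cells can be used on a single cell. *)
Lemma DG_localize v j : a < b -> V v -> (j < N)%N -> exists w, [/\ V w,
  forall y, cell x j y -> w y = v y &
  forall i y, (i < N)%N -> i != j -> cell x i y -> w y = 0].
Proof.
move=> ab [_ vpoly] jN; have [p [sp pE]] := vpoly j jN.
have [|w Vw wE] := @exists_DG (fun i => if i == j then p else 0) ab.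
  by move=> i; case: ifP => //; rewrite size_poly0.
exists w; split=> // [y cy|i y iN /negbTE ij cy].
  by rewrite (wE j)// eqxx pE.
by rewrite (wE i)// ij horner0.
Qed.

End DG_space.
End mesh.

(** * Dependence of the forms on the shift *)

Section Hform_regularity.
Context (R : realType).
Local Notation mu := (@lebesgue_measure R).

(** Tonelli applies to the positive and negative parts separately; [fine] is measurable, so infinite
    values do no harm. *)
Lemma measurable_fun_Rintegral d (T : measurableType d)
    (f : T * measurableTypeR R -> R) :
  measurable_fun setT f -> measurable_fun setT (fun s => \int[mu]_y f (s, y)).
Proof.
move=> mf; rewrite /Rintegral.
apply: (measurableT_comp (fine_measurable _)) => //.
have mE : measurable_fun setT (EFin \o f) by exact/measurable_EFinP.
rewrite (_ : (fun s => _) = (fun s => \int[mu]_y (EFin \o f)^\+ (s, y) -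
  \int[mu]_y (EFin \o f)^\- (s, y))%E); last first.
  apply/funext => s; rewrite integralE; congr (_ - _)%E.
    by apply: eq_integral => y _; rewrite !funeposE.
  by apply: eq_integral => y _; rewrite !funenegE.
apply: emeasurable_funB.
- apply: (measurable_fun_fubini_tonelli_F (m2 := mu) (EFin \o f)^\+%E) => //.
  exact: measurable_funepos.
- apply: (measurable_fun_fubini_tonelli_F (m2 := mu) (EFin \o f)^\-%E) => //.
  exact: measurable_funeneg.
Qed.

Lemma bounded_measurable_shift (s : R) (f : R -> R) : bounded_measurable setT f ->
  bounded_measurable setT (fun y : R => f (y + s)).
Proof.
apply: (@bounded_measurable_comp _ _ _ _ R (fun y : R => y + s) f).
by apply: measurable_funD => //; exact: measurable_cst.
Qed.

Context (x : nat -> R) (j : nat).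

Lemma HformE (f g : R -> R) (s : R) :
  bounded_measurable setT f -> bounded_measurable setT g ->
  Hform x j f g s =
  s^-1 * \int[mu]_(y in cell x j) ((f (y + s) - f y) * g y).
Proof.
move=> bf bg; rewrite -RintegralZl//.
- by apply: eq_Rintegral => y _; rewrite mulrA.
- exact: measurable_cell.
- apply: cell_integrable; apply: bounded_measurableM => //.
  by apply: bounded_measurableB => //; exact: bounded_measurable_shift.
Qed.

Lemma measurable_Hform (f g : R -> R) (delta : R) :
  bounded_measurable setT f -> bounded_measurable setT g ->
  measurable_fun `]0, delta[ (Hform x j f g).
Proof.
(* The factor [s^-1] is continuous away from 0; the rest becomes a parameter integral over the whole
   line with a jointly measurable integrand. *)
move=> bf bg; rewrite (_ : Hform _ _ _ _ = fun s => s^-1 *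
  \int[mu]_y (((f (y + s) - f y) * g y) * \1_(cell x j) y)); last first.
  apply/funext => s; rewrite HformE// Rintegral_mkcond; congr (_ * _).
  by apply: eq_Rintegral => y _; rewrite patch_indic.
apply: measurable_funM.
  apply: open_continuous_measurable_fun; first exact: itv_open.
  move=> s; rewrite inE /= in_itv /= => /andP[s0 _].
  by apply: inv_continuous; exact: lt0r_neq0.
apply: measurable_funS measurableT _ _ => //.
pose h (z : R * measurableTypeR R) : R :=
  ((f (z.2 + z.1 : R) - f z.2) * g z.2) * \1_(cell x j) (z.2 : R).
apply: (@measurable_fun_Rintegral _ R h).
have m2 : measurable_fun setT (fun z : R * measurableTypeR R => (z.2 : R)).
  exact: measurable_snd.
case: bf bg => [mf _] [mg _].
apply: measurable_funM; last first.
  apply: measurableT_comp m2; apply: measurable_indic; exact: measurable_cell.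
apply: measurable_funM; last exact: measurableT_comp mg m2.
apply: measurable_funB; last exact: measurableT_comp mf m2.
apply: (measurableT_comp mf); apply: measurable_funD => //.
Qed.

(* The translation by [s] leaves the cell only on a set of measure at most [s],
   which makes up for the factor [s^-1] even though [f] may jump. *)
Lemma Hform_bounded (f g : R -> R) (p : {poly R}) :
  bounded_measurable setT f -> bounded_measurable setT g ->
  (forall y, cell x j y -> f y = p.[y]) ->
  exists C : R, forall s, 0 < s -> `|Hform x j f g s| <= C.
Proof.
move=> bf bg fE; have [mf [M fM]] := bf; have [mg [W gW]] := bg.
have [L HL] := horner_lipschitz p (x j) (x j.+1).
have M0 : 0 <= M by rewrite (le_trans _ (fM 0 I)).
have W0 : 0 <= W by rewrite (le_trans _ (gW 0 I)).
(* The first term comes from the points that stay in the cell, where [f] is Lipschitz; the second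
   from those that leave it, where the difference is at most [2 * M]. *)
exists (`|L| * W * fine (mu (cell x j)) + 2 * M * W) => s s0.
(* The points of the cell that leave it under the shift lie in [E]. For large [s] the set [E] sticks
   out of the cell, but its measure [s] is still an upper bound. *)
pose E : set R := `[x j.+1 - s, x j.+1[%classic.
have mE : measurable E by exact: measurable_itv.
have bE := bounded_measurable_indic R mE.
have bint : bounded_measurable setT (fun y : R => s^-1 * (f (y + s) - f y) * g y).
  apply: bounded_measurableM => //; apply: bounded_measurableZ.
  by apply: bounded_measurableB => //; exact: bounded_measurable_shift.
have ib := cell_integrable x j bint.
have bc := @bounded_measurable_cst _ R R setT.
have bcE := bounded_measurableZ (2 * M * W / s) bE.
apply: le_trans; first by apply: le_normr_Rintegral ib; exact: measurable_cell.
have ibc := cell_integrable x j (bc (`|L| * W)).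
have ibE := cell_integrable x j bcE.
apply: (@le_trans _ _ (\int[mu]_(y in cell x j)
    (`|L| * W + 2 * M * W / s * \1_E y))).
  apply: le_Rintegral => //.
  - exact: measurable_cell.
  - exact: integrable_norm ib.
  - exact: cell_integrable (bounded_measurableD (bc (`|L| * W)) bcE).
  move=> y cy; rewrite !normrM.
  have gWy := gW y I.
  have sV : `|s^-1| = s^-1 by rewrite gtr0_norm// invr_gt0.
  rewrite sV.
  have [ys|ys] := ltP (y + s) (x j.+1).
    rewrite indicE memNset ?mulr0 ?addr0; last first.
      rewrite /E /= in_itv /= => /andP[]; lra.
    have s'0 := ltW s0; apply: ler_pM => //; first by rewrite mulr_ge0 ?invr_ge0.
    have cys : cell x j (y + s).
      by move: cy; rewrite /cell /= !in_itv /= ys andbT => /andP[]; lra.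
    rewrite mulrC ler_pdivrMr// (fE _ cy) (fE _ cys).
    have := HL (y + s) y; rewrite addrAC subrr add0r (gtr0_norm s0).
    move: cy cys; rewrite /cell /= !in_itv /= => /andP[/ltW h1 /ltW h2].
    move=> /andP[/ltW h3 /ltW h4].
    rewrite h1 h2 h3 h4 => /(_ isT isT) /le_trans; apply.
    by rewrite ler_wpM2r ?ler_norm// ltW.
  rewrite indicE mem_set ?mulr1; last first.
    move: cy; rewrite /E /cell /= !in_itv /= => /andP[_ ->].
    by rewrite andbT lerBlDr.
  rewrite -[X in X <= _]add0r lerD ?mulr_ge0//.
  have s'0 := ltW s0; rewrite [2 * M * W / s]mulrAC.
  apply: ler_pM => //; first by rewrite mulr_ge0 ?invr_ge0.
  rewrite mulrC ler_wpM2r ?invr_ge0//.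
  by rewrite (le_trans (ler_normB _ _))// mulr_natl mulr2n lerD ?fM.
rewrite RintegralD//; last exact: measurable_cell.
rewrite Rintegral_cst; last exact: measurable_cell.
rewrite lerD2l RintegralZl; last 2 first.
- exact: measurable_cell.
- exact: cell_integrable.
rewrite -[leRHS](divfK (lt0r_neq0 s0)).
have s'0 := ltW s0; rewrite ler_wpM2l ?divr_ge0 ?mulr_ge0//.
rewrite /Rintegral integral_indic//; last exact: measurable_cell.
have muE : mu E = s%:E.
  rewrite /E lebesgue_measure_itv /= lte_fin ifT; last lra.
  by rewrite -EFinB; congr EFin; lra.
rewrite -[leRHS]/(fine s%:E) -muE fine_le//.
- rewrite ge0_fin_numE// (le_lt_trans _ (cell_finite x j))//.
  by apply: le_measure; rewrite ?inE//; [apply: measurableI => //; exact: measurable_cell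
    | exact: measurable_cell].
- by rewrite muE.
- by apply: le_measure; rewrite ?inE//; apply: measurableI => //; exact: measurable_cell.
Qed.

Lemma bounded_measurable_Hform (f g : R -> R) (p : {poly R}) (delta : R) :
  bounded_measurable setT f -> bounded_measurable setT g ->
  (forall y, cell x j y -> f y = p.[y]) ->
  bounded_measurable `]0, delta[ (Hform x j f g).
Proof.
move=> bf bg fE; split; first exact: measurable_Hform.
have [C HC] := Hform_bounded bf bg fE.
by exists C => s /=; rewrite in_itv /= => /andP[/HC].
Qed.

End Hform_regularity.

(** * Summation by parts and local projections *)

Section by_parts.
Context (R : realType) (a b nu : R) (N : nat) (x : nat -> R) (k : nat).
Hypothesis hmesh : quasi_uniform_mesh a b nu N x.
Hypothesis ltab : a < b.
Local Notation mu := (@lebesgue_measure R).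
Local Notation V := (DG_space a b N x k).

(** The two integrands add up to [s^-1 * (G y - G (y - s))] with [G y = f y * g (y + s)]; since [G]
    is periodic, this integrates to 0 over one period. *)
Lemma Kform_by_parts f g (s : R) : V f -> V g ->
  \sum_(j < N) Kform x j f g s = - \sum_(j < N) Hform x j g f s.
Proof.
move=> Vf Vg; have ba : 0 < b - a by rewrite subr_gt0.
have bf := bounded_measurable_DG hmesh ltab Vf.
have bg := bounded_measurable_DG hmesh ltab Vg.
have bf' := bounded_measurable_shift (- s) bf.
have bg' := bounded_measurable_shift s bg.
have bK : bounded_measurable setT (fun y : R => s^-1 * (f y - f (y - s)) * g y).
  apply: bounded_measurableM bg; apply: bounded_measurableZ.
  exact: bounded_measurableB.
have bH : bounded_measurable setT (fun y : R => s^-1 * (g (y + s) - g y) * f y).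
  apply: bounded_measurableM bf; apply: bounded_measurableZ.
  exact: bounded_measurableB.
rewrite /Kform /Hform (Rintegral_cells hmesh bK) (Rintegral_cells hmesh bH).
apply/eqP; rewrite -subr_eq0 opprK; apply/eqP.
have itv_integrable (h : R -> R) : bounded_measurable setT h ->
    mu.-integrable `[a, b[ (EFin \o h).
  move=> bh; apply: bounded_measurable_integrable => //=.
    by rewrite lebesgue_measure_itv; case: ifP => _; rewrite ?ltry.
  exact: bounded_measurable_sub bh.
rewrite -RintegralD//; [|exact: itv_integrable|exact: itv_integrable].
pose G y := f y * g (y + s).
have bG : bounded_measurable setT G by exact: bounded_measurableM.
have bG' := bounded_measurable_shift (- s) bG.
transitivity (\int[mu]_(y in `[a, b[) (s^-1 * (G y - G (y - s)))).
  by apply: eq_Rintegral => y _; rewrite /G subrK; ring.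
rewrite RintegralZl//; last by apply: itv_integrable; exact: bounded_measurableB.
rewrite RintegralB//; [|exact: itv_integrable|exact: itv_integrable].
have Gp y : G (y + (b - a)) = G y.
  by case: Vf Vg => [fp _] [gp _]; rewrite /G fp addrAC gp.
have := Rintegral_periodic_shift a (- s) ba Gp bG.
by rewrite addrCA subrr addr0 => ->; rewrite subrr mulr0.
Qed.

End by_parts.

(** * The Gram matrix of the monomials on a cell *)

Section cell_polynomials.
Context (R : realType) (x : nat -> R) (j : nat).
Hypothesis xj : x j < x j.+1.
Local Notation mu := (@lebesgue_measure R).

Lemma Rintegral_cell_horner n (q : {poly R}) (f : R -> R) : (size q <= n)%N ->
  bounded_measurable (cell x j) f ->
  \int[mu]_(y in cell x j) (f y * q.[y]) =
  \sum_(m < n) q`_m * \int[mu]_(y in cell x j) (f y * y ^+ m).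
Proof.
move=> sq bf.
have bX m : bounded_measurable (cell x j) (fun y => f y * y ^+ m).
  apply: bounded_measurableM bf _.
  apply: bounded_measurable_ext (bounded_measurable_horner x j 'X^m) => y _.
  by rewrite hornerXn.
have bcell (g : R -> R) : bounded_measurable (cell x j) g ->
    mu.-integrable (cell x j) (EFin \o g).
  move=> bg; apply: bounded_measurable_integrable => //; last exact: cell_finite.
  exact: measurable_cell.
transitivity (\int[mu]_(y in cell x j) (\sum_(m < n) q`_m * (f y * y ^+ m))).
  apply: eq_Rintegral => y _; rewrite (horner_coef_wide _ sq) mulr_sumr.
  by apply: eq_bigr => m _; rewrite mulrCA.
rewrite Rintegral_sum; last 2 first.
- exact: measurable_cell.
- by move=> m; apply: bcell; exact: bounded_measurableZ.
apply: eq_bigr => m _; rewrite RintegralZl//; first exact: measurable_cell.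
exact: bcell.
Qed.

(** Definiteness of the Gram matrix: [p] vanishes almost everywhere on the cell, and if it were
    nonzero its finitely many roots could not cover a set of positive length up to a null set. *)
Lemma Rintegral_cell_sqr_eq0 (p : {poly R}) :
  \int[mu]_(y in cell x j) (p.[y] * p.[y]) = 0 -> p = 0.
Proof.
move=> p0; apply/eqP; apply: contraPT p0 => pN0 p0.
have bp := bounded_measurable_horner x j p.
have bpp := bounded_measurableM bp bp.
have ip : mu.-integrable (cell x j) (EFin \o (fun y => p.[y] * p.[y])).
  by apply: bounded_measurable_integrable; [exact: measurable_cell|exact: cell_finite|].
have mcell : measurable (cell x j : set (measurableTypeR R)) by exact: measurable_cell.
have : (\int[mu]_(y in cell x j) `|(p.[y] * p.[y])%:E| = 0)%E.
  under eq_integral do rewrite gee0_abs ?lee_fin -?expr2 ?sqr_ge0//.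
  apply/eqP; rewrite -[eqbLHS]fineK; last exact: integrable_fin_num ip.
  by rewrite -[X in X%:E]/(Rintegral _ _ _) p0.
move/(ae_eq_integral_abs _ mcell _).1 => /(_ _)[].
  by apply/measurable_EFinP; case: bpp.
move=> A [mA A0 subA].
have fin_roots : finite_set [set y | root p y].
  apply: contrapT => /(infinite_set_fset (size p))[B rB sB].
  have := max_poly_roots pN0 _ (finmap.fset_uniq B).
  rewrite ltnNge sB => H; suff : false by []; apply: H.
  by apply/allP => y /rB.
have : mu.-negligible (cell x j).
  apply: (@negligibleS _ _ _ _ (A `|` [set y | root p y])).
    move=> y cy; have [py|py] := eqVneq (p.[y]) 0; first by right; apply/rootP.
    left; apply: subA => /= /(_ cy) [] /eqP.
    by rewrite mulf_eq0 orbb (negbTE py).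
  apply: negligibleU; first by exists A; split.
  exists [set y | root p y]; split=> //.
    by apply: countable_measurable => //; exact: finite_set_countable.
  by apply: countable_lebesgue_measure0; exact: finite_set_countable.
move=> /(measure_negligible mcell) mu0; have : mu (cell x j) = 0%E by exact: mu0.
rewrite /cell lebesgue_measure_itv /= lte_fin xj -EFinB => /eqP.
by rewrite eqe subr_eq0 gt_eqF.
Qed.

(* The functionals [p |-> p`_l] are represented by polynomials because the Gram
   matrix of the monomials is invertible. *)
Lemma dual_monomials n : exists d : 'I_n -> {poly R},
  (forall l, (size (d l) <= n)%N) /\
  forall p : {poly R}, (size p <= n)%N -> forall l : 'I_n,
    p`_l = \int[mu]_(y in cell x j) (p.[y] * (d l).[y]).
Proof.
pose G : 'M[R]_n := \matrix_(i, l) \int[mu]_(y in cell x j) (y ^+ i * y ^+ l).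
have GC : G^T = G.
  by apply/matrixP => i l; rewrite !mxE; apply: eq_Rintegral => y _; rewrite mulrC.
have bX m : bounded_measurable (cell x j) (fun y : R => y ^+ m).
  apply: bounded_measurable_ext (bounded_measurable_horner x j 'X^m) => y _.
  by rewrite hornerXn.
have intX (p : {poly R}) (l : 'I_n) : (size p <= n)%N ->
    \int[mu]_(y in cell x j) (p.[y] * y ^+ l) = \sum_(i < n) p`_i * G i l.
  move=> sp; transitivity (\int[mu]_(y in cell x j) (y ^+ l * p.[y])).
    by apply: eq_Rintegral => y _; rewrite mulrC.
  rewrite (Rintegral_cell_horner sp (bX l)); apply: eq_bigr => i _.
  by rewrite -[G]GC !mxE.
have uG : G \in unitmx.
  (* A kernel vector, read as a polynomial, is orthogonal to all monomials, hence to itself. *)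
  rewrite unitmxE unitfE; apply/det0P => -[v vN0 vG].
  have sv : (size (rVpoly v) <= n)%N by exact: size_poly.
  have v0 : rVpoly v = 0.
    apply: Rintegral_cell_sqr_eq0.
    rewrite (Rintegral_cell_horner sv (bounded_measurable_horner x j _)).
    apply: big1 => l _; rewrite intX// [X in _ * X](_ : _ = 0) ?mulr0//.
    have /matrixP/(_ 0 l) := vG; rewrite mxE [X in _ = X]mxE => vGl.
    rewrite -[RHS]vGl.
    by apply: eq_bigr => i _; rewrite coef_rVpoly_ord.
  by move/eqP: vN0; apply; rewrite -(rVpolyK v) v0 linear0.
pose D := invmx G; have DC : D^T = D by rewrite /D trmx_inv GC.
exists (fun l => rVpoly (row l D)); split=> [l|p sp l]; first exact: size_poly.
have sd : (size (rVpoly (row l D)) <= n)%N by exact: size_poly.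
rewrite (Rintegral_cell_horner sd (bounded_measurable_horner x j _)).
(* Row [l] of the inverse Gram matrix holds the coefficients of the dual polynomial: [p *m G] lists
   the moments of [p], and [D] recovers the coefficients from them. *)
transitivity ((poly_rV p *m (G *m D)) 0 l).
  by rewrite mulmxV// mulmx1 mxE.
rewrite mulmxA mxE; apply: eq_bigr => m _.
rewrite coef_rVpoly_ord mulrC intX//; congr (_ * _).
  by rewrite -{1}DC !mxE.
by rewrite mxE; apply: eq_bigr => i _; rewrite mxE.
Qed.

End cell_polynomials.

(** * DG functions depending on the shift parameter *)

Section DG_families.
Context (R : realType) (a b nu : R) (N : nat) (x : nat -> R) (k : nat).
Hypothesis hmesh : quasi_uniform_mesh a b nu N x.
Hypothesis ltab : a < b.
Local Notation mu := (@lebesgue_measure R).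
Local Notation V := (DG_space a b N x k).

(** Here [M l] is the monomial of degree [l] on the cell and [D l] its dual. When [g] and [v] both
    vary with [s], this leaves only products with fixed test functions. *)
Lemma cell_prod_expansion j : (j < N)%N ->
  exists D M : 'I_k.+1 -> R -> R, [/\ forall l, V (D l), forall l, V (M l) &
    forall g v, bounded_measurable setT g -> V v ->
      cell_prod x j g v =
      \sum_(l < k.+1) cell_prod x j v (D l) * cell_prod x j g (M l)].
Proof.
move=> jN; have [_ _ xlt _] := hmesh.
have [d [sd dE]] := dual_monomials (xlt j jN) k.+1.
have /choice[D /all_and2[VD DE]] (l : 'I_k.+1) : exists w, V w /\
    forall y, cell x j y -> w y = (d l).[y].
  have [w Vw wE] := exists_DG hmesh ltab (fun=> sd l).
  by exists w; split=> // y; exact: wE.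
have /choice[M /all_and2[VM ME]] (l : 'I_k.+1) : exists w, V w /\
    forall y, cell x j y -> w y = y ^+ l.
  have [|w Vw wE] := @exists_DG _ _ _ _ _ _ hmesh k (fun=> 'X^l) ltab.
    by move=> _; rewrite size_polyXn.
  by exists w; split=> // y cy; rewrite (wE j)// hornerXn.
exists D, M; split=> // g v bg [_ vpoly]; have [p [sp pE]] := vpoly j jN.
have bg' : bounded_measurable (cell x j) g by exact: bounded_measurable_sub bg.
transitivity (\int[mu]_(y in cell x j) (g y * p.[y])).
  by apply: eq_Rintegral => y; rewrite inE => cy; rewrite pE.
rewrite (Rintegral_cell_horner sp bg'); apply: eq_bigr => l _; congr (_ * _).
  by rewrite dE//; apply: eq_Rintegral => y; rewrite inE => cy; rewrite pE// DE.
by apply: eq_Rintegral => y; rewrite inE => cy; rewrite ME.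
Qed.

Lemma cell_prodC j f g : cell_prod x j f g = cell_prod x j g f.
Proof. by apply: eq_Rintegral => y _; rewrite mulrC. Qed.

Lemma bounded_measurable_DG_Hform j f g (delta : R) : (j < N)%N -> V f -> V g ->
  bounded_measurable `]0, delta[ (Hform x j f g).
Proof.
move=> jN Vf Vg; have [_ /(_ j jN)[p [_ pE]]] := Vf.
exact: bounded_measurable_Hform (bounded_measurable_DG hmesh ltab Vf)
  (bounded_measurable_DG hmesh ltab Vg) pE.
Qed.

(* [q s] is the projection on [V] of the difference quotient of [u]; its
   coefficients on the cell are given by the forms [Hform]. *)
Lemma bounded_measurable_cell_prod j (delta : R) (u : R -> R) (q g : R -> R -> R) :
  (j < N)%N -> V u -> (forall s, 0 < s < delta -> V (q s)) ->
  (forall s w, 0 < s < delta -> V w -> cell_prod x j (q s) w = Hform x j u w s) ->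
  (forall s, 0 < s < delta -> bounded_measurable setT (g s)) ->
  (forall w, V w ->
    bounded_measurable `]0, delta[ (fun s => cell_prod x j (g s) w)) ->
  bounded_measurable `]0, delta[ (fun s => cell_prod x j (g s) (q s)).
Proof.
move=> jN Vu Vq qE bg gw; have [D [M [VD VM DM]]] := cell_prod_expansion jN.
apply: (@bounded_measurable_ext _ _ _ _
    (fun s => \sum_(l < k.+1) Hform x j u (D l) s * cell_prod x j (g s) (M l))).
  move=> s; rewrite inE /= in_itv /= => sd; rewrite DM; [|exact: bg|exact: Vq].
  by apply: eq_bigr => l _; rewrite qE.
apply: bounded_measurable_sum => l; apply: bounded_measurableM; last exact: gw.
exact: bounded_measurable_DG_Hform.
Qed.

Lemma sqr_L2norm f : bounded_measurable setT f ->
  (L2norm a b f ^+ 2 = (\sum_(j < N) cell_prod x j f f)%:E)%E.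
Proof.
move=> bf; have bff := bounded_measurableM bf bf.
rewrite /cell_prod (Rintegral_cells hmesh bff) /L2norm.
have iff : mu.-integrable `]a, b[ (EFin \o (fun y => f y * f y)).
  apply: bounded_measurable_integrable => //=.
    by rewrite lebesgue_measure_itv; case: ifP => _; rewrite ?ltry.
  exact: bounded_measurable_sub bff.
rewrite -Rintegral_itv_obnd_cbnd// /Rintegral fineK; last exact: integrable_fin_num.
(* The norm is defined with real exponents, the energy with a natural one. *)
have poweR2 (z : \bar R) : (0 <= z -> z `^ 2 = z ^+ 2)%E.
  by case: z => [r|_|//]; [rewrite lee_fin => r0; rewrite poweR_EFin powR_mulrn
    | rewrite poweRyr// mulyy].
rewrite -poweR2 ?Lnorm_ge0//.
rewrite poweR_Lnorm// [RHS]integral_mkcond; apply: eq_integral => y _.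
rewrite !patchE; case: ifP => _ /=.
  by rewrite powR_mulrn// -normrX ger0_norm ?sqr_ge0// expr2.
by rewrite normr0 powR0.
Qed.

End DG_families.

(** * Energy balance *)

Section energy_balance.
Context (R : realType) (a b nu : R) (N : nat) (x : nat -> R) (k : nat).
Hypothesis hmesh : quasi_uniform_mesh a b nu N x.
Hypothesis ltab : a < b.
Local Notation mu := (@lebesgue_measure R).
Local Notation V := (DG_space a b N x k).

Lemma cell_prod_linear j (c d : R) f g w : bounded_measurable setT f ->
  bounded_measurable setT g -> bounded_measurable setT w ->
  cell_prod x j (fun y => c * f y + d * g y) w =
  c * cell_prod x j f w + d * cell_prod x j g w.
Proof.
move=> bf bg bw.
have ic (e : R) h : bounded_measurable setT h ->
    mu.-integrable (cell x j) (EFin \o (fun y => e * (h y * w y))).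
  move=> bh; apply: cell_integrable; apply: bounded_measurableZ.
  exact: bounded_measurableM.
have mc : measurable (cell x j : set (measurableTypeR R)) by exact: measurable_cell.
have i1 h : bounded_measurable setT h ->
    mu.-integrable (cell x j) (EFin \o (fun y => h y * w y)).
  by move=> bh; apply: cell_integrable; exact: bounded_measurableM.
rewrite /cell_prod -!RintegralZl ?i1//.
rewrite -RintegralD ?ic//; apply: eq_Rintegral => y _; ring.
Qed.

(** Both forms are cell products with this function: [Hform] at shift [s], and [Kform] at shift
    [- s]. *)
Definition diff_quotient (f : R -> R) (s y : R) := s^-1 * (f (y + s) - f y).

Lemma bounded_measurable_diff_quotient f s : bounded_measurable setT f ->
  bounded_measurable setT (diff_quotient f s).
Proof.
move=> bf; apply: bounded_measurableZ; apply: bounded_measurableB => //.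
exact: bounded_measurable_shift.
Qed.

Lemma KformE j f g s : Kform x j f g s = cell_prod x j (diff_quotient f (- s)) g.
Proof.
by apply: eq_Rintegral => y _; rewrite /diff_quotient invrN mulNr -mulrN opprB.
Qed.

(** [Kform] evaluates [q s] at a shifted point, possibly outside the cell. Localizing [v] to the
    cell turns the form into a sum over all cells, and summation by parts moves the shift onto the
    fixed function. *)
Lemma bounded_measurable_Kform j (delta : R) (u v : R -> R) (q : R -> R -> R) :
  (j < N)%N -> V u -> V v -> (forall s, 0 < s < delta -> V (q s)) ->
  (forall i s w, (i < N)%N -> 0 < s < delta -> V w ->
    cell_prod x i (q s) w = Hform x i u w s) ->
  bounded_measurable `]0, delta[ (fun s => Kform x j (q s) v s).
Proof.
move=> jN Vu Vv Vq qE; have [w [Vw wv w0]] := DG_localize hmesh ltab Vv jN.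
have bw := bounded_measurable_DG hmesh ltab Vw.
apply: (@bounded_measurable_ext _ _ _ _
    (fun s => (-1) * \sum_(i < N) cell_prod x i (diff_quotient w s) (q s))).
  move=> s; rewrite inE /= in_itv /= => sd; rewrite mulN1r.
  rewrite -[LHS](Kform_by_parts hmesh ltab s (Vq s sd) Vw).
  rewrite (bigD1 (Ordinal jN))//= big1 ?addr0 => [|i ij].
    by apply: eq_Rintegral => y; rewrite inE => /wv ->.
  rewrite (_ : 0 = \int[mu]_(y in cell x i) 0); last first.
    by rewrite Rintegral_cst ?mul0r//; exact: measurable_cell.
  apply: eq_Rintegral => y; rewrite inE => cy.
  by rewrite (w0 i y (ltn_ord i) ij cy) mulr0.
apply: bounded_measurableZ; apply: bounded_measurable_sum => i.
apply: (bounded_measurable_cell_prod hmesh ltab (ltn_ord i) Vu Vq).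
- by move=> s z; exact: qE.
- by move=> s _; exact: bounded_measurable_diff_quotient.
- by move=> z Vz; exact: (bounded_measurable_DG_Hform hmesh ltab delta (ltn_ord i) Vw Vz).
Qed.

(** After summation by parts, testing the equations for [qp] and [qm] with their average [Q] leaves
    the product of a difference and a half-sum, that is, half a difference of squares. *)
Lemma sum_Kform_average (up um qp qm : R -> R) (s : R) :
  V up -> V um -> V qp -> V qm ->
  (forall i w, (i < N)%N -> V w -> cell_prod x i qp w = Hform x i up w s) ->
  (forall i w, (i < N)%N -> V w -> cell_prod x i qm w = Hform x i um w s) ->
  \sum_(j < N) Kform x j (fun y => (qp y + qm y) / 2) (fun y => up y - um y) s =
  - (\sum_(j < N) cell_prod x j qp qp - \sum_(j < N) cell_prod x j qm qm) / 2.
Proof.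
move=> Vup Vum Vqp Vqm qpE qmE.
set Q := fun y => (qp y + qm y) / 2; set v := fun y => up y - um y.
have QE : Q = fun y => 2^-1 * qp y + 2^-1 * qm y.
  by apply/funext => y; rewrite /Q; lra.
have vE : v = fun y => 1 * up y + (-1) * um y.
  by apply/funext => y; rewrite /v; lra.
have VQ : V Q by rewrite QE; exact: DG_linear.
have Vv : V v by rewrite vE; exact: DG_linear.
have bm f : V f -> bounded_measurable setT f := bounded_measurable_DG hmesh ltab (v := f).
have bqp := bm _ Vqp; have bqm := bm _ Vqm; have bQ := bm _ VQ.
have bdp := bounded_measurable_diff_quotient s (bm _ Vup).
have bdm := bounded_measurable_diff_quotient s (bm _ Vum).
rewrite (Kform_by_parts hmesh ltab s VQ Vv) mulNr; congr (- _).
rewrite -sumrB mulr_suml; apply: eq_bigr => i _.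
transitivity (cell_prod x i
    (fun y => 1 * diff_quotient up s y + (-1) * diff_quotient um s y) Q).
  by apply: eq_Rintegral => y _; rewrite /diff_quotient /v; ring.
rewrite cell_prod_linear//.
rewrite -[cell_prod x i (diff_quotient up s) Q]/(Hform x i up Q s).
rewrite -[cell_prod x i (diff_quotient um s) Q]/(Hform x i um Q s).
rewrite -qpE// -qmE// ![cell_prod x i _ Q]cell_prodC QE.
rewrite !cell_prod_linear// (cell_prodC _ _ qm qp); lra.
Qed.

End energy_balance.

(** * Integration in the shift and conservation of the energy *)

Lemma kernel_integrable (R : realType) (delta : R) (gamma : R -> R) :
  0 < delta -> nonlocal_kernel delta gamma ->
  (@lebesgue_measure R).-integrable `]0, delta[
    (EFin \o (fun s => s ^+ 2 * gamma s)).
Proof.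
move=> d0 [g0 _ mg /andP[_ gfin]].
have g2 (s : R) : 0 <= s ^+ 2 * gamma s by rewrite mulr_ge0 ?sqr_ge0.
have igc : (@lebesgue_measure R).-integrable `[- delta, delta]
    (EFin \o (fun s => s ^+ 2 * gamma s)).
  apply/integrableP; split.
    by apply/measurable_EFinP; apply: measurable_funM mg.
  by under eq_integral do rewrite /= ger0_norm//.
apply: integrableS igc => //= s /=; rewrite !in_itv /= => /andP[s0 sd].
by rewrite (ltW sd) andbT; lra.
Qed.

(* [B] stands for the squared norm of the middle level [q^n], about whose
   dependence on [s] nothing is known. *)
Lemma discrete_energy_split (R : realType) (delta : R) (g A : R -> R)
    (B : R -> \bar R) :
  (forall s, 0 <= g s) -> (forall s, 0 < s < delta -> 0 <= A s) ->
  (forall s, 0 <= B s)%E ->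
  (@lebesgue_measure R).-integrable `]0, delta[ (EFin \o g) ->
  bounded_measurable `]0, delta[ A ->
  (\int[lebesgue_measure]_(s in `]0%R, delta[) ((g s)%:E * ((A s)%:E + B s)) =
   (\int[lebesgue_measure]_(s in `]0%R, delta[) (g s * A s)%R)%:E +
   \int[lebesgue_measure]_(s in `]0%R, delta[) ((g s)%:E * B s))%E.
Proof.
move=> g0 A0 B0 ig bA.
have igA : (@lebesgue_measure R).-integrable `]0, delta[
    (EFin \o (fun s => g s * A s)) by exact: integrable_bounded_measurableM.
transitivity (\int[lebesgue_measure]_(s in `]0%R, delta[)
    ((g s * A s)%:E + (g s)%:E * B s))%E.
  apply: eq_integral => s; rewrite inE /= in_itv /= => sd.
  by rewrite EFinM ge0_muleDr// lee_fin A0.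
rewrite ge0_integralD_nonmeasurable//.
- by rewrite /Rintegral fineK//; exact: integrable_fin_num igA.
- by move=> s /=; rewrite in_itv /= => sd; rewrite mulr_ge0 ?A0.
- by move=> s _; rewrite mule_ge0 ?lee_fin.
Qed.

Theorem theorem4p1 (R : realType)
  (a b T delta ht nu : R) (gamma : R -> R)
  (N k Nt : nat) (x t : nat -> R)
  (u : nat -> R -> R) (q : nat -> R -> R -> R)
  (ltab : a < b) (T_gt0 : 0 < T) (delta_gt0 : 0 < delta) (nu_gt0 : 0 < nu)
  (hgamma : nonlocal_kernel delta gamma)
  (hgrid : uniform_time_grid T ht Nt t)
  (hmesh : quasi_uniform_mesh a b nu N x)
  (hscheme : CN_DG_scheme a b delta ht gamma N x k Nt u q) :
  forall n : nat, (1 <= n <= Nt - 1)%N ->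
    discrete_energy a b delta ht gamma u q n.+1 =
    discrete_energy a b delta ht gamma u q n.
Proof.
move=> n nNt; case: hscheme => Vu Vq wave aux.
have ht_gt0 : 0 < ht by case: hgrid.
have [n0 nNt'] : (0 < n)%N /\ (n < Nt)%N by lia.
rewrite /discrete_energy succnK.
have {}Vup := Vu n.+1 nNt'; have Vu0 := Vu n (ltnW nNt').
have Vum : DG_space a b N x k (u n.-1) by apply: Vu; lia.
have sdelta s : 0 < s < delta -> 0 < s <= delta.
  by move=> /andP[-> /ltW ->].
have Vqp s (sd : 0 < s < delta) := Vq n.+1 s nNt' (sdelta s sd).
have Vqm s (sd : 0 < s < delta) : DG_space a b N x k (q n.-1 s).
  by apply: Vq; [lia | exact: sdelta].
have qpE i s w : (i < N)%N -> 0 < s < delta -> DG_space a b N x k w ->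
    cell_prod x i (q n.+1 s) w = Hform x i (u n.+1) w s.
  by move=> iN sd Vw; have [/eqP + _] := aux n i s w nNt iN (sdelta s sd) Vw;
    rewrite subr_eq0 => /eqP.
have qmE i s w : (i < N)%N -> 0 < s < delta -> DG_space a b N x k w ->
    cell_prod x i (q n.-1 s) w = Hform x i (u n.-1) w s.
  by move=> iN sd Vw; have [_ /eqP +] := aux n i s w nNt iN (sdelta s sd) Vw;
    rewrite subr_eq0 => /eqP.
(* Only the three time levels involved remain; [q0] enters solely through its norm in the two
   energies. *)
move: (u n.+1) (u n) (u n.-1) (q n.+1) (q n.-1) (q n) Vup Vu0 Vum Vqp Vqm qpE qmE
  (wave n) => up u0 um qp qm q0 Vup Vu0 Vum Vqp Vqm qpE qmE {}wave.
have inD s : s \in (`]0, delta[%classic : set R) -> 0 < s < delta.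
  by rewrite inE /= in_itv.
set g := fun s => s ^+ 2 * gamma s.
have g0 s : 0 <= g s by rewrite mulr_ge0 ?sqr_ge0//; case: hgamma.
have ig : (@lebesgue_measure R).-integrable `]0, delta[ (EFin \o g).
  exact: kernel_integrable.
pose v y := up y - um y.
have vE : v = fun y => 1 * up y + (-1) * um y.
  by apply/funext => y; rewrite /v; lra.
have Vv : DG_space a b N x k v by rewrite vE; exact: DG_linear.
pose dp y := (up y - u0 y) / ht; pose dm y := (u0 y - um y) / ht.
have dpE : dp = fun y => ht^-1 * up y + (- ht^-1) * u0 y.
  by apply/funext => y; rewrite /dp; ring.
have dmE : dm = fun y => ht^-1 * u0 y + (- ht^-1) * um y.
  by apply/funext => y; rewrite /dm; ring.
have bm f : DG_space a b N x k f -> bounded_measurable setT f :=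
  bounded_measurable_DG hmesh ltab (v := f).
have bdp : bounded_measurable setT dp by rewrite dpE; apply/bm/DG_linear.
have bdm : bounded_measurable setT dm by rewrite dmE; apply/bm/DG_linear.
pose P s := \sum_(j < N) cell_prod x j (qp s) (qp s).
pose M s := \sum_(j < N) cell_prod x j (qm s) (qm s).
(* Both factors vary with [s], so the expansion is applied with [g = z]; tested against a fixed
   function, [z s] is again a form [Hform]. *)
have family w (z : R -> R -> R) : DG_space a b N x k w ->
    (forall s, 0 < s < delta -> DG_space a b N x k (z s)) ->
    (forall i s f, (i < N)%N -> 0 < s < delta -> DG_space a b N x k f ->
      cell_prod x i (z s) f = Hform x i w f s) ->
    bounded_measurable `]0, delta[ (fun s => \sum_(j < N) cell_prod x j (z s) (z s)).
  move=> Vw Vz zE; apply: bounded_measurable_sum => i.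
  apply: (bounded_measurable_cell_prod hmesh ltab (ltn_ord i) Vw Vz).
  - by move=> s f; exact: zE.
  - by move=> s /Vz /bm.
  - move=> f Vf; apply: bounded_measurable_ext
      (bounded_measurable_DG_Hform hmesh ltab delta (ltn_ord i) Vw Vf).
    by move=> s /inD sd; rewrite zE.
have bP : bounded_measurable `]0, delta[ P by exact: family Vup Vqp qpE.
have bM : bounded_measurable `]0, delta[ M by exact: family Vum Vqm qmE.
have sum_ge0 f : 0 <= \sum_(j < N) cell_prod x j f f.
  apply: sumr_ge0 => j _; apply: Rintegral_ge0 => y _.
  by rewrite -expr2 sqr_ge0.
pose B s := (L2norm a b (q0 s) ^+ 2)%E.
have B0 s : (0 <= B s)%E.
  by rewrite /B expe2 mule_ge0// Lnorm_ge0.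
(* The second difference quotient is [(dp - dm) / ht], and [v = ht * (dp + dm)]. *)
have kinetic j : (j < N)%N ->
    cell_prod x j (fun y => (up y - 2 * u0 y + um y) / ht ^+ 2) v =
    cell_prod x j dp dp - cell_prod x j dm dm.
  move=> jN; have idp : (@lebesgue_measure R).-integrable (cell x j)
      (EFin \o (fun y => dp y * dp y)).
    by apply: cell_integrable; exact: bounded_measurableM.
  have idm : (@lebesgue_measure R).-integrable (cell x j)
      (EFin \o (fun y => dm y * dm y)).
    by apply: cell_integrable; exact: bounded_measurableM.
  rewrite /cell_prod -RintegralB//; last exact: measurable_cell.
  apply: eq_Rintegral => y _; rewrite /v /dp /dm; field; exact: lt0r_neq0.
pose K j s := Kform x j (fun y => (qp s y + qm s y) / 2) v s.
have bK j : (j < N)%N -> bounded_measurable `]0, delta[ (K j).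
  move=> jN.
  have bKp := bounded_measurable_Kform hmesh ltab jN Vup Vv Vqp qpE.
  have bKm := bounded_measurable_Kform hmesh ltab jN Vum Vv Vqm qmE.
  apply: bounded_measurable_ext (bounded_measurableZ 2^-1 (bounded_measurableD bKp bKm)).
  move=> s /inD sd; rewrite mulrDr !KformE.
  rewrite -cell_prod_linear; last 3 first.
  - exact/bounded_measurable_diff_quotient/bm/Vqp.
  - exact/bounded_measurable_diff_quotient/bm/Vqm.
  - exact: bm.
  rewrite /K KformE; apply: eq_Rintegral => y _; rewrite /diff_quotient.
  by congr (_ * _); lra.
have igf f : bounded_measurable `]0, delta[ f ->
    (@lebesgue_measure R).-integrable `]0, delta[ (EFin \o (fun s => g s * f s)).
  by move=> bf; apply: integrable_bounded_measurableM.
have balance : \sum_(j < N) cell_prod x j dp dp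
      + \int[lebesgue_measure]_(s in `]0, delta[) (g s * P s) =
    \sum_(j < N) cell_prod x j dm dm
      + \int[lebesgue_measure]_(s in `]0, delta[) (g s * M s).
  (* The factor 2 of the scheme will cancel the one half produced by [sum_Kform_average]. *)
  have waveK j : (j < N)%N -> cell_prod x j dp dp - cell_prod x j dm dm =
      2 * \int[lebesgue_measure]_(s in `]0, delta[) (g s * K j s).
    by move=> jN; rewrite -kinetic//; apply/subr0_eq; exact: wave.
  have igK (j : 'I_N) := igf _ (bK j (ltn_ord j)).
  have igP := igf _ bP; have igM := igf _ bM.
  have swap (y1 y2 z1 z2 : R) : y1 - y2 = z2 - z1 -> y1 + z1 = y2 + z2 by lra.
  apply: swap; rewrite -sumrB.
  under eq_bigr => j _ do rewrite (waveK j (ltn_ord j)).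
  rewrite -mulr_sumr.
  rewrite -Rintegral_sum//; under eq_Rintegral do rewrite -mulr_sumr.
  have bKs : bounded_measurable `]0, delta[ (fun s => \sum_(j < N) K j s).
    by apply: bounded_measurable_sum => j; exact: bK.
  rewrite -RintegralB// -RintegralZl//; last exact: igf.
  apply: eq_Rintegral => s /inD sd.
  have qps i w iN := qpE i s w iN sd; have qms i w iN := qmE i s w iN sd.
  have := sum_Kform_average hmesh ltab Vup Vum (Vqp s sd) (Vqm s sd) qps qms.
  rewrite -/(P s) -/(M s) => ->; lra.
rewrite (sqr_L2norm hmesh bdp) (sqr_L2norm hmesh bdm).
transitivity ((\sum_(j < N) cell_prod x j dp dp)%:E +
    \int[lebesgue_measure]_(s in `]0%R, delta[)
      ((g s)%:E * ((P s)%:E + B s)))%E.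
  congr (_ + _)%E; apply: eq_integral => s /inD sd.
  by rewrite (sqr_L2norm hmesh (bm _ (Vqp s sd))).
transitivity ((\sum_(j < N) cell_prod x j dm dm)%:E +
    \int[lebesgue_measure]_(s in `]0%R, delta[)
      ((g s)%:E * ((M s)%:E + B s)))%E; last first.
  congr (_ + _)%E; apply: eq_integral => s /inD sd.
  by rewrite (sqr_L2norm hmesh (bm _ (Vqm s sd))) addeC.
have P0 s (_ : 0 < s < delta) : 0 <= P s := sum_ge0 (qp s).
have M0 s (_ : 0 < s < delta) : 0 <= M s := sum_ge0 (qm s).
rewrite (discrete_energy_split g0 P0 B0 ig bP).
rewrite (discrete_energy_split g0 M0 B0 ig bM).
(* The contribution [w] of the middle level may be infinite; it is only added to both sides of the
   real balance, never cancelled. *)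
have assoc (y1 y2 z1 z2 : R) (w : \bar R) : y1 + z1 = y2 + z2 ->
  (y1%:E + (z1%:E + w) = y2%:E + (z2%:E + w))%E by rewrite !addeA -!EFinD => ->.
exact: assoc balance.
Qed.
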